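(* Let $n\ge2$ and $0\le i<j\le n-1$. Let $A$ be a graded algebra generated by $u,v$ in degree $1$, carrying a grading-preserving $H_{2n^2}$-module algebra structure with $A_1=\Bbbk u\oplus\Bbbk v=\pi_{i,j}(u,v)$. Then the action of $H_{2n^2}$ on $A$ is inner-faithful if and only if $(i^2-j^2,n)=1$.
   Context: Ground field $\Bbbk=\mathbb{C}$. An action of a Hopf algebra $H$ on an $H$-module algebra $A$ is inner-faithful if the only Hopf ideal $I$ of $H$ with $I\cdot A=0$ is $I=0$. $H_{2n^2}$ (Pansera), $n\ge2$: let $q=e^{2\pi\sqrt{-1}/n}$, $G=\langle x\rangle\times\langle y\rangle$ with $x,y$ of order $n$, $J=\frac1n\sum_{r,s=0}^{n-1}q^{-rs}x^r\otimes y^s$. $H_{2n^2}$ is generated by $\Bbbk G$ and $z$ with $zx=yz$, $zy=xz$, $z^2=\frac1n\sum_{r,s}q^{-rs}x^ry^s$; it has basis $x^ry^sz^k$ ($0\le r,s\le n-1$, $k=0,1$); $x,y$ are grouplike, $\Delta(z)=J(z\otimes z)$, $\epsilon(z)=1$, $S(z)=z$. $\pi_{i,j}(u,v)$ is the two-dimensional module with ordered basis $u,v$ and $xu=q^iu$, $xv=q^jv$, $yu=q^ju$, $yv=q^iv$, $zu=q^{ij}v$, $zv=u$. *)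

(* Defs.v *)
From HB Require Import structures.
From mathcomp Require Import all_boot all_order all_algebra all_field.
From mathcomp Require Import complex.
From mathcomp Require Import reals trigo.

Set Implicit Arguments.
Unset Strict Implicit.
Unset Printing Implicit Defensive.

Import GRing.Theory.
Local Open Scope ring_scope.

(* Tensor products of finite-dimensional spaces.  An element of U ⊗ V is
   represented by the matrix of its coordinates in the basis
   (vbasis {:U})`_i ⊗ (vbasis {:V})`_j.  [tens] is the canonical bilinear map
   and [tlift f] is the linear map on U ⊗ V induced by a bilinear f; so, if t
   is \sum_k u_k ⊗ v_k, then tlift f t is \sum_k f u_k v_k
   (see [tens_bilinear], [tlift_tens] and [tens_span]). *)
Section Tensor.
Variables (K : fieldType) (U V : vectType K).

Definition tensor := 'M[K]_(\dim {:U}, \dim {:V}).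
HB.instance Definition _ := Vector.on tensor.

Definition tens (u : U) (v : V) : tensor :=
  \matrix_(i, j) (coord (vbasis {:U}) i u * coord (vbasis {:V}) j v).

Definition tlift (W : lmodType K) (f : U -> V -> W) (t : tensor) : W :=
  \sum_(i < \dim {:U}) \sum_(j < \dim {:V})
    (t : 'M_(_, _)) i j *: f (vbasis {:U})`_i (vbasis {:V})`_j.

Definition bilinear_map (W : lmodType K) (f : U -> V -> W) : Prop :=
  (forall v, linear (fun u => f u v)) /\ (forall u, linear (f u)).

Lemma tens_bilinear : bilinear_map tens.
Proof.
split=> [v a u u' | u a v v']; apply/matrixP=> i j; rewrite !mxE linearP /=.
  by rewrite mulrDl mulrA.
by rewrite mulrDr mulrCA.
Qed.

Lemma tlift_linear (W : lmodType K) (f : U -> V -> W) : linear (tlift f).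
Proof.
move=> a s t; rewrite /tlift scaler_sumr -big_split /=; apply: eq_bigr => i _.
rewrite scaler_sumr -big_split /=; apply: eq_bigr => j _.
by rewrite !mxE scalerDl scalerA.
Qed.

Lemma tlift_tens (W : lmodType K) (f : U -> V -> W) (u : U) (v : V) :
  bilinear_map f -> tlift f (tens u v) = f u v.
Proof.
move=> [fl fr].
pose FL v' : {linear U -> W} :=
  HB.pack (fun u' => f u' v') (GRing.isLinear.Build K U W _ _ (fl v')).
pose FR u' : {linear V -> W} :=
  HB.pack (f u') (GRing.isLinear.Build K V W _ _ (fr u')).
rewrite [in RHS](coord_vbasis (memvf u)) -[RHS]/(FL v _) linear_sum.
apply: eq_bigr => i _; rewrite linearZ /=.
rewrite [in RHS](coord_vbasis (memvf v)) -[f _ _ in RHS]/(FR _ _) linear_sum.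
rewrite scaler_sumr; apply: eq_bigr => j _.
by rewrite linearZ scalerA mxE.
Qed.

Lemma tens_span (t : tensor) : tlift tens t = t.
Proof.
have free_vb (T : vectType K) : free (vbasis {:T}).
  exact: basis_free (vbasisP _).
apply/matrixP=> k l; rewrite /tlift summxE (bigD1 k) //= summxE (bigD1 l) //=.
rewrite [X in _ + _ + X]big1 => [|i ik]; last first.
  rewrite summxE big1 // => j _.
  by rewrite !mxE !coord_free // (negPf ik) mul0r mulr0.
rewrite big1 => [|j jl]; last first.
  by rewrite !mxE !coord_free // (negPf jl) !mulr0.
by rewrite !mxE !coord_free // !eqxx !mulr1 !addr0.
Qed.

End Tensor.

Notation "u ⊗ v" := (tens u v) (at level 40) : ring_scope.

Section Hopf.
Variables (K : fieldType) (H : falgType K).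

Definition tmul (s t : tensor H H) : tensor H H :=
  tlift (fun a b => tlift (fun c d => (a * c) ⊗ (b * d)) t) s.

Record hopf_algebra := HopfAlgebra {
  comul : {linear H -> tensor H H};
  counit : {scalar H};
  antipode : {linear H -> H};
  comul1 : comul 1 = 1 ⊗ 1;
  comulM : forall g h, comul (g * h) = tmul (comul g) (comul h);
  counit1 : counit 1 = 1;
  counitM : forall g h, counit (g * h) = counit g * counit h;
  comulA : forall h,
    tlift (fun a b => tlift (fun a1 a2 => a1 ⊗ (a2 ⊗ b)) (comul a)) (comul h)
    = tlift (fun a b => a ⊗ comul b) (comul h)
      :> tensor H (tensor H H);
  counitl : forall h, tlift (fun a b => counit a *: b) (comul h) = h;
  counitr : forall h, tlift (fun a b => counit b *: a) (comul h) = h;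
  antipodel : forall h,
    tlift (fun a b => antipode a * b) (comul h) = counit h *: 1;
  antipoder : forall h,
    tlift (fun a b => a * antipode b) (comul h) = counit h *: 1
}.

Variable hopf : hopf_algebra.

(* t lies in I ⊗ H + H ⊗ I. *)
Definition in_ideal_tensor (I : {vspace H}) (t : tensor H H) : Prop :=
  exists s : seq (H * H),
    all (fun p => (p.1 \in I) || (p.2 \in I)) s
    /\ t = \sum_(p <- s) p.1 ⊗ p.2.

Record hopf_ideal (I : {vspace H}) : Prop := HopfIdeal {
  hopf_ideal_mull : forall h a, a \in I -> h * a \in I;
  hopf_ideal_mulr : forall h a, a \in I -> a * h \in I;
  hopf_ideal_comul : forall a, a \in I -> in_ideal_tensor I (comul hopf a);
  hopf_ideal_counit : forall a, a \in I -> counit hopf a = 0;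
  hopf_ideal_antipode : forall a, a \in I -> antipode hopf a \in I
}.

Record module_algebra (A : algType K) (act : H -> A -> A) : Prop := ModuleAlgebra {
  act_linearl : forall a, linear (fun h => act h a);
  act_linearr : forall h, linear (act h);
  act_1l : forall a, act 1 a = a;
  act_mull : forall g h a, act (g * h) a = act g (act h a);
  act_1r : forall h, act h 1 = counit hopf h *: 1;
  act_mulr : forall h a b,
    act h (a * b) = tlift (fun h1 h2 => act h1 a * act h2 b) (comul hopf h)
}.

Definition inner_faithful (A : algType K) (act : H -> A -> A) : Prop :=
  forall I : {vspace H},
    hopf_ideal I -> (forall h a, h \in I -> act h a = 0) -> I = 0%VS.

End Hopf.

Section Graded.
Variables (K : fieldType) (A : algType K).

Record is_grading (gr : nat -> {pred A}) : Prop := IsGrading {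
  grading_submod : forall d, GRing.submod_closed (gr d);
  grading_one : 1 \in gr 0%N;
  grading_mul : forall d e a b, a \in gr d -> b \in gr e -> a * b \in gr (d + e)%N;
  grading_sum : forall a, exists (N : nat) (f : nat -> A),
    (forall d, f d \in gr d) /\ a = \sum_(d < N) f d;
  grading_direct : forall (N : nat) (f : nat -> A),
    (forall d, f d \in gr d) -> \sum_(d < N) f d = 0 ->
    forall d, (d < N)%N -> f d = 0
}.

Definition generated_by2 (u v : A) : Prop :=
  forall S : {pred A}, GRing.subalg_closed S -> u \in S -> v \in S ->
  forall a, a \in S.

Definition ordered_basis2 (B : {pred A}) (u v : A) : Prop :=
  (forall a, a \in B <-> exists c d : K, a = c *: u + d *: v)
  /\ (forall c d : K, c *: u + d *: v = 0 -> c = 0 /\ d = 0).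

End Graded.

Section Pansera.
Variable R : realType.
Local Open Scope complex_scope.

Definition rootq (n : nat) : R[i] :=
  cos (2 * pi / n%:R) +i* sin (2 * pi / n%:R).

Section Presentation.
Variables (H : falgType R[i]) (n : nat) (x y z : H).
Let q := rootq n.

Definition pansera_J : tensor H H :=
  n%:R^-1 *: \sum_(r < n) \sum_(s < n) q ^- (r * s) *: ((x ^+ r) ⊗ (y ^+ s)).

Definition pansera_mJ : H :=
  n%:R^-1 *: \sum_(r < n) \sum_(s < n) q ^- (r * s) *: (x ^+ r * y ^+ s).

(* (H, hopf) is H_{2n^2}, with its distinguished generators x, y, z.  The basis
   condition makes the relations a full presentation, and x, y of order exactly
   n; it also determines H up to an isomorphism that fixes x, y, z. *)
Record is_pansera (hopf : hopf_algebra H) : Prop := IsPansera {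
  pansera_xn : x ^+ n = 1;
  pansera_yn : y ^+ n = 1;
  pansera_xy : x * y = y * x;
  pansera_zx : z * x = y * z;
  pansera_zy : z * y = x * z;
  pansera_zz : z ^+ 2 = pansera_mJ;
  pansera_basis : basis_of {:H}
    [seq x ^+ (nat_of_ord p.1.1) * y ^+ (nat_of_ord p.1.2) * z ^+ (nat_of_ord p.2)
       | p : 'I_n * 'I_n * 'I_2];
  pansera_comulx : comul hopf x = x ⊗ x;
  pansera_comuly : comul hopf y = y ⊗ y;
  pansera_comulz : comul hopf z = tmul pansera_J (z ⊗ z);
  pansera_counitx : counit hopf x = 1;
  pansera_counity : counit hopf y = 1;
  pansera_counitz : counit hopf z = 1;
  pansera_antipodez : antipode hopf z = z
}.

Record is_pi (V : lmodType R[i]) (act : H -> V -> V) (i j : nat) (u v : V) : Prop :=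
  IsPi {
  pi_xu : act x u = q ^+ i *: u;
  pi_xv : act x v = q ^+ j *: v;
  pi_yu : act y u = q ^+ j *: u;
  pi_yv : act y v = q ^+ i *: v;
  pi_zu : act z u = q ^+ (i * j) *: v;
  pi_zv : act z v = u
}.

End Presentation.
End Pansera.

(* Main.v *)
From HB Require Import structures.
Require Import Defs.
From mathcomp Require Import all_boot all_order all_algebra all_field.
From mathcomp Require Import complex.
From mathcomp Require Import reals trigo.
From mathcomp Require Import ring lra zify.

(** Why the theorem holds.  Write q for the primitive n-th root of unity.

    Suppose first that j^2 - i^2 and n have a common prime factor p; then p
    divides j - i or j + i, and for m = n / p the grouplike element
    g = x^m y^(-m) or g = x^m y^m fixes both u and v, hence all of A, since the
    fixed points of a grouplike element form a subalgebra.  Exchanging x and y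
    sends g to its inverse or to itself, so g z is z g^-1 or z g, and the left
    ideal H (g - 1) is two-sided.  It is then a Hopf ideal
    ([augmentation_hopf_ideal]); it is nonzero because g != 1, and it
    annihilates A.

    Suppose conversely that j^2 - i^2 is prime to n, and let I be a Hopf ideal
    that annihilates A.  The relevant linear functionals on H are
      chi_k,a,b : x^r y^s z^l |-> q^(a r + b s) if l = k, and 0 otherwise.
    The matrix coefficients of the representation on u, v are, up to powers of
    q, the four functionals chi_0,i,j, chi_0,j,i, chi_1,i,j, chi_1,j,i
    ([action_coefficients]), so these vanish on I.  The functionals that vanish
    on a Hopf ideal are stable under convolution, and the convolution of
    chi_k,a,b with chi_k,c,d is chi_k,a+c,b+d up to a power of q
    ([chi_convolution0], [chi_convolution1]); for k = 1 the
    orthogonality of characters absorbs the twist J in the coproduct of z.  Hence the pairs (a, b)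
    for which both chi_k,a,b vanish on I form a subgroup of (Z/n)^2 that
    contains (i, j) and (j, i).  The determinant i^2 - j^2 of these two vectors
    is invertible modulo n, so the subgroup is everything ([killed_all]), and
    Fourier inversion on the basis x^r y^s z^l gives I = 0
    ([chi_separates]). *)

Set Implicit Arguments.
Unset Strict Implicit.
Unset Printing Implicit Defensive.

Import Order.TTheory GRing.Theory Num.Theory.
Local Open Scope ring_scope.

(** * Tensors and uniqueness of the antipode *)

Section TensorTheory.
Variable K : fieldType.

HB.instance Definition _ (U V : vectType K) (W : lmodType K) (f : U -> V -> W) :=
  GRing.isLinear.Build K (tensor U V) W _ (tlift f) (tlift_linear f).

Lemma linear_tlift (U V : vectType K) (W W' : lmodType K)
    (L : {linear W -> W'}) (f : U -> V -> W) t :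
  L (tlift f t) = tlift (fun a b => L (f a b)) t.
Proof.
rewrite /tlift linear_sum; apply: eq_bigr => i _.
by rewrite linear_sum; apply: eq_bigr => j _; rewrite linearZ.
Qed.

Lemma eq_tlift (U V : vectType K) (W : lmodType K) (f g : U -> V -> W) t :
  (forall a b, f a b = g a b) -> tlift f t = tlift g t.
Proof.
by move=> fg; apply: eq_bigr => i _; apply: eq_bigr => j _; rewrite fg.
Qed.

Lemma tensZl (U V : vectType K) k (a : U) (b : V) : (k *: a) ⊗ b = k *: (a ⊗ b).
Proof. by apply/matrixP=> i j; rewrite !mxE linearZ mulrA. Qed.

Lemma tensBl (U V : vectType K) (a a' : U) (b : V) :
  (a - a') ⊗ b = a ⊗ b - a' ⊗ b.
Proof. by apply/matrixP=> i j; rewrite !mxE linearB mulrBl. Qed.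

Lemma tensBr (U V : vectType K) (a : U) (b b' : V) :
  a ⊗ (b - b') = a ⊗ b - a ⊗ b'.
Proof. by apply/matrixP=> i j; rewrite !mxE linearB mulrBr. Qed.

(** Pure tensors absorb scalars, so additivity is the only closure property
    needed to reach all tensors. *)
Lemma tensor_ind (U V : vectType K) (P : tensor U V -> Prop) :
    P 0 -> (forall s t, P s -> P t -> P (s + t)) ->
    (forall a b, P (a ⊗ b)) ->
  forall t, P t.
Proof.
move=> P0 PD Pt t; rewrite -[t]tens_span /tlift.
apply: big_ind => // i _; apply: big_ind => // j _.
by rewrite -tensZl; apply: Pt.
Qed.

Variable H : falgType K.
Implicit Types (a b c d h : H).

Lemma tens_mulr_bilinear a b :
  bilinear_map (fun c d => (a * c) ⊗ (b * d)).
Proof.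
have [tl tr] := @tens_bilinear K H H.
split=> [d k c c'|c k d d']; rewrite mulrDr -scalerAr.
  exact: tl.
exact: tr.
Qed.

Lemma tens_mul_bilinear (t : tensor H H) :
  bilinear_map (fun a b => tlift (fun c d => (a * c) ⊗ (b * d)) t).
Proof.
have [tl tr] := @tens_bilinear K H H.
split=> [b k a a'|a k b b']; rewrite /tlift scaler_sumr -big_split /=;
  apply: eq_bigr => i _; rewrite scaler_sumr -big_split /=;
  apply: eq_bigr => j _; rewrite mulrDl -scalerAl scalerA [k * _]mulrC.
  by rewrite tl scalerDr scalerA.
by rewrite tr scalerDr scalerA.
Qed.

Lemma tmul_tens a b c d : tmul (a ⊗ b) (c ⊗ d) = (a * c) ⊗ (b * d).
Proof.
rewrite /tmul tlift_tens; last exact: tens_mul_bilinear.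
by rewrite tlift_tens //; apply: tens_mulr_bilinear.
Qed.

Lemma tmulDl (s t w : tensor H H) : tmul (s + t) w = tmul s w + tmul t w.
Proof. exact: linearD. Qed.

Lemma tmulZl k (t w : tensor H H) : tmul (k *: t) w = k *: tmul t w.
Proof. exact: linearZ. Qed.

Lemma tmul0l (w : tensor H H) : tmul 0 w = 0.
Proof. exact: linear0. Qed.

Lemma tmul_suml (J : Type) (r : seq J) (P : pred J) (F : J -> tensor H H) w :
  tmul (\sum_(i <- r | P i) F i) w = \sum_(i <- r | P i) tmul (F i) w.
Proof. exact: linear_sum. Qed.

Lemma tmul_tensr_linear a b : linear (tmul (a ⊗ b)).
Proof.
move=> k s t; rewrite /tmul !tlift_tens; try exact: tens_mul_bilinear.
exact: linearP.
Qed.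

HB.instance Definition _ a b :=
  GRing.isLinear.Build K (tensor H H) (tensor H H) _ (tmul (a ⊗ b))
    (tmul_tensr_linear a b).

Lemma tmul_tensZr a b k t : tmul (a ⊗ b) (k *: t) = k *: tmul (a ⊗ b) t.
Proof. exact: linearZ. Qed.

Lemma tmul_tens_sumr a b (J : Type) (r : seq J) (P : pred J)
    (F : J -> tensor H H) :
  tmul (a ⊗ b) (\sum_(i <- r | P i) F i) = \sum_(i <- r | P i) tmul (a ⊗ b) (F i).
Proof. exact: linear_sum. Qed.

Section Hopf.
Variable hopf : hopf_algebra H.
Local Notation Delta := (comul hopf).
Local Notation eps := (counit hopf).
Local Notation S := (antipode hopf).

Definition grouplike g := Delta g = g ⊗ g.

Lemma grouplike1 : grouplike 1.
Proof. exact: comul1. Qed.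

Lemma grouplikeM g h : grouplike g -> grouplike h -> grouplike (g * h).
Proof. by rewrite /grouplike comulM => -> ->; rewrite tmul_tens. Qed.

Lemma grouplikeX g k : grouplike g -> grouplike (g ^+ k).
Proof.
move=> gg; elim: k => [|k IHk]; first exact: grouplike1.
by rewrite exprS; apply: grouplikeM.
Qed.

Lemma mul_bilinear (f g : {linear H -> H}) : bilinear_map (fun a b => f a * g b).
Proof.
split=> [b k a a'|a k b b']; rewrite linearP.
  by rewrite mulrDl scalerAl.
by rewrite mulrDr scalerAr.
Qed.

Lemma counit_grouplike g : grouplike g -> g != 0 -> eps g = 1.
Proof.
move=> gg g0; have := counitl hopf g; rewrite gg tlift_tens.
  by move/eqP; rewrite -subr_eq0 -[X in _ - X]scale1r -scalerBl scaler_eq0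
    (negPf g0) orbF subr_eq0 => /eqP.
split=> [b k a a'|a k b b'].
  by rewrite linearP scalerDl scalerA.
by rewrite scalerDr !scalerA mulrC.
Qed.

(** In the convolution algebra of endomorphisms of H, a right inverse T of the
    identity equals the left inverse S:  S h = S h1 * (h2 * T h3) =
    (S h1 * h2) * T h3 = T h.  The map Phi, a ⊗ (b ⊗ c) |-> S a * b * T c,
    carries coassociativity to the equality of the two outer terms. *)
Lemma antipode_unique (T : {linear H -> H}) :
  (forall h, tlift (fun a b => a * T b) (Delta h) = eps h *: 1) -> T =1 S.
Proof.
move=> Tr h; pose Phi2 a := tlift (fun b c => S a * b * T c).
have Phi2E a t : Phi2 a t = S a * tlift (fun b c => b * T c) t.
  have mulE d : S a * d = amull (S a) d by rewrite lfunE.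
  rewrite mulE linear_tlift.
  by apply: eq_tlift => b c; rewrite /= -mulE mulrA.
pose Phi : tensor H (tensor H H) -> H := tlift Phi2.
have Phi2_bil a : bilinear_map (fun b c => S a * b * T c).
  split=> [c k b b'|b k c c']; rewrite ?linearP mulrDr -?scalerAr //.
  by rewrite mulrDl -scalerAl.
have Phi_bil : bilinear_map Phi2.
  split=> [t k a a'|a]; last exact: tlift_linear.
  by rewrite !Phi2E linearP mulrDl -scalerAl.
have := congr1 Phi (comulA hopf h); rewrite /Phi !linear_tlift.
have -> : tlift (fun a b => tlift Phi2 (a ⊗ Delta b)) (Delta h) = S h.
  rewrite -[in RHS](counitr hopf h) linear_tlift; apply: eq_tlift => a b.
  by rewrite tlift_tens // Phi2E Tr linearZ -scalerAr mulr1.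
move=> <-; rewrite -[in LHS](counitl hopf h) linear_tlift.
apply: eq_tlift => a b; rewrite linearZ /= -[T b]mul1r scalerAl -antipodel.
have mulE d : d * T b = amulr (T b) d by rewrite lfunE.
rewrite linear_tlift mulE linear_tlift.
by apply: eq_tlift => a1 a2; rewrite /= -mulE tlift_tens // /Phi2 tlift_tens.
Qed.

End Hopf.
End TensorTheory.

(** * The Hopf ideal generated by a grouplike element minus one *)

Section GrouplikeIdeal.
Variables (K : fieldType) (H : falgType K) (hopf : hopf_algebra H).
Local Notation Delta := (comul hopf).
Local Notation eps := (counit hopf).
Local Notation S := (antipode hopf).
Implicit Types (g h : H).

(** The part of the antimultiplicativity of S that is needed,
    S (h g) = g^-1 S h: the map h |-> g S (h g) is also a right convolution
    inverse of the identity, because h1 g S (h2 g) is (h g)1 S ((h g)2). *)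
Lemma antipode_mulr_grouplike g h :
  grouplike hopf g -> g != 0 -> g * S (h * g) = S h.
Proof.
move=> gg g0; pose T := (amull g \o (S \o amulr g))%FUN : {linear H -> H}.
have TE d : T d = g * S (d * g) by rewrite /T /= !lfunE.
rewrite -TE; apply: (antipode_unique (hopf := hopf)) => {}h.
have := antipoder hopf (h * g).
rewrite counitM (counit_grouplike gg g0) mulr1 comulM gg => <-.
rewrite /tmul linear_tlift; apply: eq_tlift => a b.
rewrite tlift_tens; last exact: tens_mulr_bilinear.
rewrite /= tlift_tens; last exact: (mul_bilinear idfun S).
by rewrite !lfunE /= mulrA.
Qed.

Lemma in_ideal_tensorD (I : {vspace H}) s t :
  in_ideal_tensor I s -> in_ideal_tensor I t -> in_ideal_tensor I (s + t).
Proof.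
move=> [r [rI ->]] [r' [r'I ->]]; exists (r ++ r').
by rewrite all_cat rI big_cat.
Qed.

(** The left ideal H (g - 1), as the image of right multiplication by g - 1. *)
Definition augmentation_ideal g : {vspace H} := (amulr (g - 1) @: fullv)%VS.

Lemma augmentation_idealP g a :
  reflect (exists h, a = h * (g - 1)) (a \in augmentation_ideal g).
Proof.
apply: (iffP memv_imgP) => [[h _ ->]|[h ->]]; exists h; rewrite ?memvf //.
  by rewrite lfunE.
by rewrite lfunE.
Qed.

(** The coproduct condition comes from
    a g ⊗ b g - a ⊗ b = a (g - 1) ⊗ b g + a ⊗ b (g - 1),
    the antipode condition from S (h g) = g^-1 S h. *)
Lemma augmentation_hopf_ideal g :
    grouplike hopf g -> g \is a GRing.unit ->
    (forall h, exists h', (g - 1) * h = h' * (g - 1)) ->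
  hopf_ideal hopf (augmentation_ideal g).
Proof.
move=> gg gU gN; have g0 : g != 0 by apply: contraTneq gU => ->; rewrite unitr0.
split=> [h _ /augmentation_idealP[h' ->]|h _ /augmentation_idealP[h' ->]
        |_ /augmentation_idealP[h ->]|_ /augmentation_idealP[h ->]
        |_ /augmentation_idealP[h ->]].
- by apply/augmentation_idealP; exists (h * h'); rewrite mulrA.
- have [h'' gh] := gN h.
  by apply/augmentation_idealP; exists (h' * h''); rewrite -!mulrA gh.
- rewrite mulrBr mulr1 linearB /= comulM gg.
  elim/tensor_ind: (Delta h) => [|s t sI tI|a b].
  + by rewrite tmul0l subr0; exists [::]; rewrite big_nil.
  + by rewrite tmulDl opprD addrACA; apply: in_ideal_tensorD.
  exists [:: (a * (g - 1), b * g); (a, b * (g - 1))]; split.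
    apply/and3P; split=> //=; apply/orP; [left|right];
      by apply/augmentation_idealP; eexists.
  rewrite tmul_tens !big_cons big_nil /= addr0 !mulrBr !mulr1 tensBl tensBr.
  by rewrite addrA subrK.
- by rewrite counitM linearB /= counit1 (counit_grouplike gg g0) subrr mulr0.
apply/augmentation_idealP.
have [h' gh] := gN (S (h * g)); exists (- h').
rewrite mulNr -gh mulrBl mul1r antipode_mulr_grouplike //.
by rewrite mulrBr mulr1 linearB opprB.
Qed.

End GrouplikeIdeal.

(** * Grouplike elements acting on a module algebra *)

Section ModuleAlgebra.
Variables (K : fieldType) (H : falgType K) (hopf : hopf_algebra H).
Variables (A : algType K) (act : H -> A -> A).
Hypothesis A_modalg : module_algebra hopf act.

Lemma act_exp_eigen g a k m :
  act g a = k *: a -> act (g ^+ m) a = k ^+ m *: a.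
Proof.
move=> ga; elim: m => [|m IHm]; first by rewrite !expr0 (act_1l A_modalg) ?scale1r.
rewrite exprSr (act_mull A_modalg) ga.
by rewrite (scalable_linear (act_linearr A_modalg _)) /= IHm scalerA -exprS.
Qed.

(** The fixed points of a grouplike element form a subalgebra. *)
Lemma act_grouplike_fixes g u v :
    grouplike hopf g -> g != 0 -> generated_by2 u v ->
    act g u = u -> act g v = v ->
  forall a, act g a = a.
Proof.
move=> gg g0 gen gu gv a.
suff: a \in [pred b | act g b == b] by move/eqP.
apply: gen; rewrite ?inE ?gu ?gv //; split.
- by rewrite inE (act_1r A_modalg) (counit_grouplike gg g0) scale1r.
- move=> k b c /eqP gb /eqP gc.
  by rewrite inE (act_linearr A_modalg) gb gc.
move=> b c /eqP gb /eqP gc; rewrite inE (act_mulr A_modalg) gg tlift_tens.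
  by rewrite gb gc.
split=> [h k d d'|d k h h']; rewrite (act_linearl A_modalg).
  by rewrite mulrDl scalerAl.
by rewrite mulrDr scalerAr.
Qed.

Lemma not_inner_faithful g u v :
    grouplike hopf g -> g \is a GRing.unit -> g != 1 ->
    (forall h, exists h', (g - 1) * h = h' * (g - 1)) ->
    generated_by2 u v -> act g u = u -> act g v = v ->
  ~ inner_faithful hopf act.
Proof.
move=> gg gU g1 gN gen gu gv faith.
have g0 : g != 0 by apply: contraTneq gU => ->; rewrite unitr0.
have I0 : augmentation_ideal g = 0%VS.
  apply: faith; first exact: augmentation_hopf_ideal.
  move=> _ a /augmentation_idealP[h ->].
  have := act_linearl A_modalg a (-1) h (h * g); rewrite !scaleN1r.
  rewrite [- h + _]addrC mulrBr mulr1 => ->.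
  by rewrite (act_mull A_modalg) (act_grouplike_fixes gg g0 gen gu gv) addNr.
have : g - 1 \in augmentation_ideal g.
  by apply/augmentation_idealP; exists 1; rewrite mul1r.
by rewrite I0 memv0 subr_eq0 (negPf g1).
Qed.

End ModuleAlgebra.

(** * Convolution and roots of unity *)

(** An element of I ⊗ H + H ⊗ I is a sum of pure tensors with one factor in I,
    where one of f, g is zero; this is what makes the functionals vanishing on a
    Hopf ideal stable under convolution. *)
Lemma convolution_vanish (K : fieldType) (H : falgType K) (hopf : hopf_algebra H)
    (I : {vspace H}) (f g : {linear H -> K^o}) (h : H) :
    hopf_ideal hopf I -> {in I, forall a, f a = 0} -> {in I, forall a, g a = 0} ->
  h \in I -> tlift (fun a b => f a * g b : K^o) (comul hopf h) = 0.
Proof.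
move=> idI fI gI /(hopf_ideal_comul idI)[s [sI ->]].
rewrite linear_sum big_seq big1 // => -[a b] /(allP sI)/= abI.
rewrite tlift_tens.
  by case/orP: abI => [/fI|/gI] ->; rewrite ?mul0r ?mulr0.
split=> [c k d d'|c k d d']; rewrite linearP.
  by rewrite mulrDl -scalerAl.
by rewrite mulrDr -scalerAr.
Qed.

(** Orthogonality of the characters of Z/n. *)
Lemma sum_prim_root_expr (F : fieldType) n (q : F) r s :
    n.-primitive_root q ->
  \sum_(a < n) q ^- (a * r) * q ^+ (a * s) = n%:R * (r == s %[mod n])%:R.
Proof.
move=> qn; have q0 k : q ^+ k != 0.
  by rewrite expf_neq0 // (prim_root_eq0 qn) -lt0n (prim_order_gt0 qn).
pose w := q ^+ s / q ^+ r.
have wE (a : 'I_n) : true -> q ^- (a * r) * q ^+ (a * s) = w ^+ a.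
  by rewrite mulrC /w exprMn exprVn -!exprM ![(_ * a)%N]mulnC.
rewrite (eq_bigr _ wE) -(eq_prim_root_expr qn).
have [qrs|qrs] := eqVneq (q ^+ r) (q ^+ s).
  rewrite /w qrs divff // (eq_bigr (fun=> 1)) => [|a _]; last exact: expr1n.
  by rewrite sumr_const card_ord mulr1.
rewrite mulr0; have := subrX1 w n.
rewrite {1}/w exprMn exprVn -!exprM ![(_ * n)%N]mulnC !exprM (prim_expr_order qn).
rewrite !expr1n invr1 mulr1 subrr => /esym/eqP.
rewrite mulf_eq0 subr_eq0 => /orP[/eqP w1|/eqP//].
by case/eqP: qrs; rewrite -[RHS](divfK (q0 r)) -/w w1 mul1r.
Qed.

Section RootOfUnity.
Variable R : realType.
Local Open Scope complex_scope.

Lemma rootqX n k :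
  rootq R n ^+ k = cos (2 * pi / n%:R * k%:R) +i* sin (2 * pi / n%:R * k%:R).
Proof.
rewrite /rootq; move: (2 * pi / n%:R) => t.
elim: k => [|k IHk]; first by rewrite expr0 mulr0 cos0 sin0.
rewrite exprSr IHk -[k.+1%:R]natr1 mulrDr mulr1 cosD sinD.
by apply/eqP; rewrite eq_complex /= eqxx /= addrC.
Qed.

(** If q^k = 1 then cos (2 t) = 1 for t = pi k / n, so sin t = 0; but t lies
    strictly between 0 and pi when 0 < k < n. *)
Lemma rootq_prim n : (0 < n)%N -> n.-primitive_root (rootq R n).
Proof.
move=> n0; have nR : n%:R != 0 :> R by rewrite pnatr_eq0 -lt0n.
apply/andP; split=> //; apply/forallP => k; apply/eqP.
rewrite unity_rootE rootqX; have [->|kn] := eqVneq k.+1 n.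
  by rewrite divfK // mulrC mulr_natr cos2pi sin2pi eqxx.
have kn' : (k.+1 < n)%N by rewrite ltn_neqAle kn ltn_ord.
rewrite eq_complex /=; apply/negbTE; apply/negP=> /andP[/eqP c1 _].
pose t : R := pi / n%:R * k.+1%:R.
have st : 0 < sin t.
  apply: sin_gt0_pi; apply/andP; split.
    by rewrite !mulr_gt0 ?pi_gt0 ?invr_gt0 ?ltr0n.
  rewrite /t -mulrA gtr_pMr ?pi_gt0 // mulrC ltr_pdivrMr ?ltr0n //.
  by rewrite mul1r ltr_nat.
have := cos2Dsin2 t; have := cos_mulr2n t.
have -> : t *+ 2 = 2 * pi / n%:R * k.+1%:R by rewrite /t; ring.
by rewrite c1; nra.
Qed.

End RootOfUnity.

(** * Arithmetic of the exponents *)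

(** For a common prime factor p and a = n / p, take b = - a modulo n if p divides
    j - i, and b = a if p divides j + i. *)
Lemma noncoprime_sub_sqr n i j :
    (0 < n)%N -> (i <= j)%N -> ~~ coprime (j ^ 2 - i ^ 2) n ->
  exists a b, [/\ (0 < a < n)%N, b = a \/ b = (n - a)%N,
    (n %| i * a + j * b)%N & (n %| j * a + i * b)%N].
Proof.
move=> n_gt0 le_ij ncop; set d := gcdn (j ^ 2 - i ^ 2) n.
pose p := pdiv d; have pr_p : prime p.
  by rewrite pdiv_prime // ltn_neqAle eq_sym gcdn_gt0 n_gt0 orbT andbT.
have /dvdnP[m nE] : (p %| n)%N by rewrite (dvdn_trans (pdiv_dvd _)) ?dvdn_gcdr.
have p_D : (p %| j ^ 2 - i ^ 2)%N by rewrite (dvdn_trans (pdiv_dvd _)) ?dvdn_gcdl.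
have m_gt0 : (0 < m)%N by move: n_gt0; rewrite nE muln_gt0 => /andP[].
have m_ltn : (m < n)%N.
  by rewrite nE -[X in (X < _)%N]muln1 ltn_pmul2l // prime_gt1.
have n_dvd c : (p %| c)%N -> (n %| m * c)%N by rewrite nE dvdn_pmul2l.
move: p_D; rewrite subn_sqr Euclid_dvdM // => /orP[/n_dvd n_sub|/n_dvd n_add].
  have le_im : (i * m <= i * n)%N by rewrite leq_mul2l ltnW ?orbT.
  have le_jm : (j * m <= j * n)%N by rewrite leq_mul2l ltnW ?orbT.
  have le_mi : (m * i <= m * j)%N by rewrite leq_mul2l le_ij orbT.
  exists m, (n - m)%N; split; rewrite ?m_gt0 //; first by right.
    rewrite -(dvdn_addl _ n_sub).
    have -> : (i * m + j * (n - m) + m * (j - i) = j * n)%N.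
      by rewrite !mulnBr; lia.
    exact: dvdn_mull.
  have -> : (j * m + i * (n - m) = i * n + m * (j - i))%N.
    by rewrite !mulnBr; lia.
  by rewrite dvdn_add // dvdn_mull.
exists m, m; split; rewrite ?m_gt0 //; first by left.
  by rewrite -mulnDl addnC mulnC.
by rewrite -mulnDl mulnC.
Qed.

Lemma absz_sub_sqr i j : (i <= j)%N ->
  `|i%:Z ^+ 2 - j%:Z ^+ 2|%N = (j ^ 2 - i ^ 2)%N.
Proof.
move=> le_ij; rewrite -opprB abszN !expr2 -!PoszM subzn ?mulnn ?leq_sqr //.
Qed.

(** * Monomials and functionals *)

(** A linear map in h with two scalar coordinates; the instance lets it be
    compared with h |-> act h w on monomials. *)
Section ScaledSum.
Variables (K : fieldType) (H A : lmodType K).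

Definition scaled_sum (f g : {linear H -> K^o}) (u v : A) h : A :=
  (f h : K) *: u + (g h : K) *: v.

Lemma scaled_sum_linear f g u v : linear (scaled_sum f g u v).
Proof.
have fE (f' : {linear H -> K^o}) k a b : f' (k *: a + b) = k * f' a + f' b.
  exact: linearP.
by move=> k a b; rewrite /scaled_sum !fE !scalerDl scalerDr !scalerA addrACA.
Qed.

HB.instance Definition _ f g u v :=
  GRing.isLinear.Build K H A _ (scaled_sum f g u v) (scaled_sum_linear f g u v).

End ScaledSum.

Section Monomials.
Variables (R : realType) (n : nat) (H : falgType R[i]) (x y z : H).
Hypothesis n_gt0 : (0 < n)%N.
Variable hopf : hopf_algebra H.
Hypothesis H_pansera : is_pansera n x y z hopf.
Local Notation K := R[i].
Local Notation Delta := (comul hopf).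
Local Notation q := (rootq R n).

Definition mono r s l : H := x ^+ r * y ^+ s * z ^+ l.

Let mono_index (t : 'I_n * 'I_n * 'I_2) : H := mono t.1.1 t.1.2 t.2.

Let mono_basis : basis_of {:H} [seq mono_index t | t : 'I_n * 'I_n * 'I_2].
Proof. exact: pansera_basis H_pansera. Qed.

Let qn1 : q ^+ n = 1.
Proof. exact: prim_expr_order (rootq_prim R n_gt0). Qed.

Lemma eq_linear_mono (W : lmodType K) (f g : {linear H -> W}) :
    (forall r s l, (r < n)%N -> (s < n)%N -> (l < 2)%N ->
       f (mono r s l) = g (mono r s l)) ->
  f =1 g.
Proof.
move=> fg h; set X := [seq mono_index t | t : 'I_n * 'I_n * 'I_2].
rewrite (coord_basis (X := in_tuple X) mono_basis (memvf h)) !linear_sum.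
apply: eq_bigr => i _; rewrite !linearZ; congr (_ *: _).
have /mapP[t _ ->] : (in_tuple X)`_i \in X by exact: mem_nth.
exact: fg.
Qed.

Lemma mono_mod r s l : mono (r %% n) (s %% n) l = mono r s l.
Proof.
by rewrite /mono (expr_mod _ (pansera_xn H_pansera))
  (expr_mod _ (pansera_yn H_pansera)).
Qed.

(** For k = 0 these are the characters of the group algebra of <x, y> extended by
    zero on the span of the x^r y^s z; for k = 1 they live on that span. *)
Definition chi k a b : {linear H -> K^o} :=
  sval (linear_of_free [seq mono_index t | t : 'I_n * 'I_n * 'I_2]
    [seq (nat_of_ord t.2 == k)%:R * q ^+ (a * t.1.1 + b * t.1.2)
       | t : 'I_n * 'I_n * 'I_2] : {f : {linear H -> K^o} | _}).

Lemma chi_mono k a b r s l : (l < 2)%N ->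
  chi k a b (mono r s l) = (l == k)%:R * q ^+ (a * r + b * s).
Proof.
move=> l2.
have cE t : chi k a b (mono_index t) =
    (nat_of_ord t.2 == k)%:R * q ^+ (a * t.1.1 + b * t.1.2).
  rewrite /chi; case: linear_of_free => f /= fE.
  have := fE (basis_free mono_basis); rewrite !size_map => /(_ erefl).
  by rewrite -map_comp => /eq_in_map; apply; rewrite mem_enum.
rewrite -mono_mod.
have := cE (Ordinal (ltn_pmod r n_gt0), Ordinal (ltn_pmod s n_gt0), Ordinal l2).
rewrite /mono_index /= => ->; congr (_ * _).
by rewrite -[LHS](expr_mod _ qn1) -[RHS](expr_mod _ qn1) -modnDm !modnMmr modnDm.
Qed.

Lemma eq_chi_mod k a b a' b' : a = a' %[mod n] -> b = b' %[mod n] ->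
  chi k a b =1 chi k a' b'.
Proof.
move=> aa' bb'; apply: eq_linear_mono => r s l _ _ l2; rewrite !chi_mono //.
congr (_ * _); rewrite -[LHS](expr_mod _ qn1) -[RHS](expr_mod _ qn1).
rewrite -[in LHS]modnDm -[(a * r %% n)%N]modnMml -[(b * s %% n)%N]modnMml aa' bb'.
by rewrite !modnMml modnDm.
Qed.

Let xy_comm r s : y ^+ s * x ^+ r = x ^+ r * y ^+ s.
Proof. by apply/esym/commrX/commr_sym/commrX/esym/(pansera_xy H_pansera). Qed.

Lemma mono0 r s : mono r s 0 = x ^+ r * y ^+ s.
Proof. by rewrite /mono expr0 mulr1. Qed.

Lemma mono1 r s : mono r s 1 = x ^+ r * y ^+ s * z.
Proof. by []. Qed.

Lemma grouplike_mono0 r s : grouplike hopf (mono r s 0).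
Proof.
rewrite mono0; apply: grouplikeM; apply: grouplikeX.
  exact: pansera_comulx H_pansera.
exact: pansera_comuly H_pansera.
Qed.

Lemma comul_mono1 r s : Delta (mono r s 1) =
  n%:R^-1 *: \sum_(r' < n) \sum_(s' < n)
    q ^- (r' * s') *: (mono (r + r')%N s 1 ⊗ mono r (s + s')%N 1).
Proof.
rewrite {1}mono1 -mono0 comulM grouplike_mono0 (pansera_comulz H_pansera).
rewrite /pansera_J tmulZl tmul_tensZr tmul_suml tmul_tens_sumr.
congr (_ *: _); apply: eq_bigr => r' _.
rewrite tmul_suml tmul_tens_sumr; apply: eq_bigr => s' _.
rewrite tmulZl tmul_tensZr !tmul_tens mono0 !mono1 !exprD !mulrA.
by rewrite -[x ^+ r * _ * x ^+ r']mulrA xy_comm mulrA.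
Qed.

Let chi_mul_bilinear k l a b c d :
  bilinear_map (fun g h => chi k a b g * chi l c d h : K^o).
Proof.
split=> [h m g g'|g m h h']; rewrite linearP.
  by rewrite mulrDl -scalerAl.
by rewrite mulrDr -scalerAr.
Qed.

Let n_neq0 : n%:R != 0 :> K.
Proof. by rewrite pnatr_eq0 -lt0n. Qed.

(** The sum over r selects s = a modulo n.  This is what the twist J contributes
    to a convolution of functionals on the span of the x^r y^s z. *)
Lemma sum_rootq_cross a d :
  \sum_(r < n) \sum_(s < n) q ^- (r * s) * q ^+ (a * r + d * s)
  = n%:R * q ^+ (a * d).
Proof.
rewrite exchange_big /=; transitivity
  (\sum_(s < n) n%:R * (nat_of_ord s == a %[mod n])%:R * q ^+ (d * s)).
  apply: eq_bigr => s _; rewrite -(sum_prim_root_expr _ _ (rootq_prim R n_gt0)).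
  rewrite mulr_suml; apply: eq_bigr => r _.
  by rewrite -mulrA -exprD [(a * r)%N]mulnC.
rewrite (bigD1 (Ordinal (ltn_pmod a n_gt0))) //= big1 => [|s sa].
  rewrite modn_mod eqxx mulr1 addr0; congr (_ * _).
  by rewrite -[LHS](expr_mod _ qn1) -[RHS](expr_mod _ qn1) modnMmr mulnC.
rewrite modn_small // (_ : _ == _ = false) ?mulr0 ?mul0r //.
by apply: contraNF sa => /eqP sa; apply/eqP/val_inj.
Qed.

Definition convolution k a b c d : H -> K^o :=
  tlift (fun g h => chi k a b g * chi k c d h) \o Delta.

Lemma chi_convolution0 a b c d :
  convolution 0 a b c d =1 chi 0 (a + c)%N (b + d)%N.
Proof.
apply: (eq_linear_mono (f := tlift _ \o Delta)) => r s [|[|//]] _ _ _ /=.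
  rewrite grouplike_mono0 tlift_tens; last exact: chi_mul_bilinear.
  by rewrite !chi_mono // !mul1r -exprD; congr (_ ^+ _); ring.
rewrite comul_mono1 linearZ linear_sum /= big1 => [|r' _].
  by rewrite scaler0 chi_mono // mul0r.
rewrite linear_sum big1 // => s' _; rewrite linearZ /= tlift_tens.
  by rewrite chi_mono // !mul0r scaler0.
exact: chi_mul_bilinear.
Qed.

Lemma chi_convolution1 a b c d h :
  convolution 1 a b c d h = q ^+ (a * d) * chi 1 (a + c)%N (b + d)%N h.
Proof.
move: h; apply: (eq_linear_mono (f := tlift _ \o Delta)
  (g := q ^+ (a * d) \*: chi 1 (a + c)%N (b + d)%N)) => r s [|[|//]] _ _ _ /=.
  rewrite grouplike_mono0 tlift_tens; last exact: chi_mul_bilinear.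
  by rewrite !chi_mono // !mul0r scaler0.
rewrite comul_mono1 linearZ linear_sum /=.
transitivity (n%:R^-1 * (q ^+ ((a + c) * r + (b + d) * s) * (n%:R * q ^+ (a * d)))).
  rewrite -sum_rootq_cross mulr_sumr; congr (_ * _).
  apply: eq_bigr => r' _; rewrite linear_sum mulr_sumr; apply: eq_bigr => s' _.
  rewrite linearZ /= tlift_tens; last exact: chi_mul_bilinear.
  rewrite !chi_mono // !mul1r -exprD mulrCA -exprD; congr (_ * _ ^+ _); ring.
rewrite chi_mono // mul1r [LHS]mulrCA mulKf // mulrC.
by [].
Qed.

(** * Separation of elements and propagation of vanishing *)

Lemma mono_expansion h : exists c : 'I_n * 'I_n * 'I_2 -> K,
  h = \sum_t c t *: mono t.1.1 t.1.2 t.2.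
Proof.
set X := [seq mono_index t | t : 'I_n * 'I_n * 'I_2].
have szX : size X = #|{: 'I_n * 'I_n * 'I_2}| by rewrite size_map cardE.
exists (fun t => coord (in_tuple X) (cast_ord (esym szX) (enum_rank t)) h).
rewrite {1}(coord_basis (X := in_tuple X) mono_basis (memvf h)).
rewrite (reindex (fun t => cast_ord (esym szX) (enum_rank t))) /=.
  apply: eq_bigr => t _; congr (_ *: _).
  by rewrite (nth_map t) -?cardE // nth_enum_rank.
exists (enum_val \o cast_ord szX) => [t _|i _] /=.
  by rewrite cast_ordKV enum_rankK.
by rewrite enum_valK cast_ordK.
Qed.

(** Fourier inversion: summing q^(- a r - b s) chi_k,a,b over a and b recovers
    n^2 times the coefficient of x^r y^s z^k. *)
Lemma chi_separates h :
  (forall k a b, (k < 2)%N -> chi k a b h = 0) -> h = 0.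
Proof.
move=> chi0; have [c hE] := mono_expansion h.
rewrite hE big1 // => -[[r s] k] _; apply/eqP; rewrite scaler_eq0; apply/orP; left.
have : \sum_(a < n) \sum_(b < n)
    q ^- (a * r) * q ^- (b * s) * chi k a b h = c (r, s, k) * (n%:R * n%:R).
  transitivity (\sum_t c t * (t.2 == k)%:R *
    ((\sum_(a < n) q ^- (a * r) * q ^+ (a * t.1.1)) *
     (\sum_(b < n) q ^- (b * s) * q ^+ (b * t.1.2)))).
    under [RHS]eq_bigr => t _ do rewrite big_distrlr mulr_sumr.
    rewrite [RHS]exchange_big; apply: eq_bigr => a _ /=.
    under [RHS]eq_bigr => t _ do rewrite mulr_sumr.
    rewrite [RHS]exchange_big; apply: eq_bigr => b _ /=.
    rewrite {1}hE linear_sum mulr_sumr; apply: eq_bigr => t _.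
    rewrite linearZ /= chi_mono // exprD -[_ *: _]/(c t * _).
    by rewrite (inj_eq val_inj); ring.
  under eq_bigr => t _ do rewrite !(sum_prim_root_expr _ _ (rootq_prim R n_gt0)).
  rewrite (bigD1 (r, s, k)) //= big1 => [|[[r' s'] k'] neq] /=.
    by rewrite !eqxx !mulr1 addr0.
  rewrite !modn_small //.
  have [kk|] := eqVneq k' k; last by rewrite mulr0 mul0r.
  have [rr|] := eqVneq (r : nat) r'; last by rewrite mulr0 mul0r mulr0.
  have [ss|] := eqVneq (s : nat) s'; last by rewrite !mulr0.
  by case/eqP: neq; rewrite kk (val_inj rr) (val_inj ss).
rewrite big1 => [/esym/eqP|a _]; last first.
  by rewrite big1 // => b _; rewrite chi0 ?mulr0.
by rewrite !mulf_eq0 (negPf n_neq0) !orbF.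
Qed.

(** Both families k = 0, 1 are tracked together: convolution stays inside each of
    them, and they are needed together to separate the elements of H. *)
Definition killed (I : {vspace H}) a b :=
  forall k, (k < 2)%N -> {in I, forall h, chi k a b h = 0}.

Lemma killed_mod I a b a' b' : a = a' %[mod n] -> b = b' %[mod n] ->
  killed I a b -> killed I a' b'.
Proof.
by move=> aa' bb' kab k k2 h hI; rewrite -(eq_chi_mod k aa' bb') kab.
Qed.

Lemma killedD I a b c d : hopf_ideal hopf I ->
  killed I a b -> killed I c d -> killed I (a + c)%N (b + d)%N.
Proof.
move=> idI kab kcd [|[|//]] _ h hI.
  rewrite -chi_convolution0; apply: (convolution_vanish idI) => //.
    exact: kab.
  exact: kcd.
have q0 : q ^+ (a * d) != 0.
  by rewrite expf_neq0 // (prim_root_eq0 (rootq_prim R n_gt0)) -lt0n.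
apply: (mulfI q0); rewrite mulr0 -chi_convolution1.
apply: (convolution_vanish idI) => //; first exact: kab.
exact: kcd.
Qed.

Lemma killedX I a b m : hopf_ideal hopf I ->
  killed I a b -> killed I (m * a)%N (m * b)%N.
Proof.
move=> idI kab; have kX p : killed I (p.+1 * a)%N (p.+1 * b)%N.
  by elim: p => [|p IHp]; rewrite ?mul1n // ![(p.+2 * _)%N]mulSn; apply: killedD.
(* Only nonempty sums are available; m + n summands work for m = 0 too. *)
apply: killed_mod (kX (m + n.-1)%N); rewrite -addnS prednK //.
  by rewrite mulnDl addnC [(n * _)%N]mulnC modnMDl.
by rewrite mulnDl addnC [(n * _)%N]mulnC modnMDl.
Qed.

(** Cramer's rule modulo n: j (j, i) - i (i, j) = (D, 0) and
    j (i, j) - i (j, i) = (0, D), with D = j^2 - i^2 invertible. *)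
Lemma killed_all I i j : hopf_ideal hopf I -> (i < j)%N ->
    coprime (j ^ 2 - i ^ 2)%N n -> killed I i j -> killed I j i ->
  I = 0%VS.
Proof.
move=> idI lt_ij co kij kji; set D := (j ^ 2 - i ^ 2)%N in co.
have D_gt0 : (0 < D)%N by rewrite subn_gt0 ltn_exp2r.
have DE : (j * j = D + i * i)%N by rewrite !mulnn subnK // ltnW // -subn_gt0.
(* n.-1 stands for -1, since only sums of pairs are available. *)
have first_mod : (j * j + n.-1 * i * i = D %[mod n])%N.
  by rewrite DE -addnA -mulnA -mulSn prednK // mulnC addnC modnMDl.
have second_mod : (j * i + n.-1 * i * j = 0 %[mod n])%N.
  by rewrite [(j * i)%N]mulnC -mulnA -mulSn prednK // mulnC modnMl mod0n.
have kD0 : killed I D 0.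
  apply: killed_mod first_mod second_mod _.
  exact: killedD idI (killedX j idI kji) (killedX (n.-1 * i)%N idI kij).
have k0D : killed I 0 D.
  apply: killed_mod second_mod first_mod _.
  exact: killedD idI (killedX j idI kij) (killedX (n.-1 * i)%N idI kji).
have [[m w] /= mw] := coprimeP n D_gt0 co.
have mD : (m * D)%N = (w * n + 1)%N by lia.
have kill_all a b : killed I a b.
  have := killedD idI (killedX (a * m)%N idI kD0) (killedX (b * m)%N idI k0D).
  by apply: killed_mod; rewrite muln0 ?addn0 ?add0n -mulnA mD mulnDr muln1
    mulnA modnMDl.
apply/eqP; rewrite -subv0; apply/subvP => h hI; rewrite memv0; apply/eqP.
by apply: chi_separates => k a b k2; apply: kill_all.
Qed.

(** * The representation on u, v and the two implications *)

(** Both sides are linear in h, and on monomials they follow from the eigenvalues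
    of x and y and the way z exchanges the two lines. *)
Lemma action_coefficients (A : algType K) (act : H -> A -> A) i j u v :
    module_algebra hopf act -> is_pi n x y z act i j u v -> forall h,
    act h u = chi 0 i j h *: u + (q ^+ (i * j) * chi 1 j i h) *: v /\
    act h v = chi 1 i j h *: u + chi 0 j i h *: v.
Proof.
move=> Amod pi_uv h.
pose L w : {linear H -> A} := HB.pack (fun h => act h w)
  (GRing.isLinear.Build K H A _ _ (act_linearl Amod w)).
have act_mono0 w a b r s : act x w = q ^+ a *: w -> act y w = q ^+ b *: w ->
    act (mono r s 0) w = q ^+ (a * r + b * s) *: w.
  move=> xw yw; rewrite mono0 (act_mull Amod) (act_exp_eigen Amod _ yw).
  rewrite (scalable_linear (act_linearr Amod _)) /= (act_exp_eigen Amod _ xw).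
  by rewrite scalerA -!exprM -exprD addnC.
have xyu r s := act_mono0 u i j r s (pi_xu pi_uv) (pi_yu pi_uv).
have xyv r s := act_mono0 v j i r s (pi_xv pi_uv) (pi_yv pi_uv).
split.
  apply: (eq_linear_mono (f := L u) (g := scaled_sum _ (_ \*: chi 1 j i) u v)).
  move=> r s [|[|//]] _ _ _ /=; rewrite /scaled_sum /= !chi_mono // ?mul0r ?mul1r.
    by rewrite xyu scaler0 scale0r addr0.
  rewrite mono1 -mono0 (act_mull Amod) (pi_zu pi_uv) scale0r add0r.
  by rewrite (scalable_linear (act_linearr Amod _)) /= xyv scalerA.
apply: (eq_linear_mono (f := L v) (g := scaled_sum _ _ u v)).
move=> r s [|[|//]] _ _ _ /=; rewrite /scaled_sum /= !chi_mono // ?mul0r ?mul1r.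
  by rewrite xyv scale0r add0r.
by rewrite mono1 -mono0 (act_mull Amod) (pi_zv pi_uv) xyu scale0r addr0.
Qed.

Lemma faithful_of_coprime (A : algType K) (act : H -> A -> A) i j u v :
    module_algebra hopf act -> is_pi n x y z act i j u v ->
    (forall c d : K, c *: u + d *: v = 0 -> c = 0 /\ d = 0) ->
    (i < j)%N -> coprime (j ^ 2 - i ^ 2)%N n ->
  inner_faithful hopf act.
Proof.
move=> Amod pi_uv uv_free lt_ij co I idI I0.
have coefs h : h \in I -> [/\ chi 0 i j h = 0, chi 1 j i h = 0,
    chi 1 i j h = 0 & chi 0 j i h = 0].
  move=> hI; have [hu hv] := action_coefficients Amod pi_uv h.
  have [|u0 /eqP] := uv_free (chi 0 i j h) (q ^+ (i * j) * chi 1 j i h).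
    by rewrite -hu I0.
  have [|v1 v0] := uv_free (chi 1 i j h) (chi 0 j i h); first by rewrite -hv I0.
  rewrite mulf_eq0 expf_eq0 (prim_root_eq0 (rootq_prim R n_gt0)) (gtn_eqF n_gt0).
  by rewrite andbF => /eqP u1.
apply: (killed_all idI lt_ij co) => -[|[|//]] _ h /coefs[] //.
Qed.

(** The functional chi_0,1,0 distinguishes x^a y^b from 1. *)
Lemma mono_neq1 a b : (0 < a < n)%N -> mono a b 0 != 1.
Proof.
case/andP=> a_gt0 lt_an; apply/eqP=> /(congr1 (chi 0 1 0)).
have -> : 1 = mono 0 0 0 by rewrite mono0 !expr0 mulr1.
rewrite !chi_mono // !mul1r muln0 !mul0n !addn0 mul1n => /eqP.
by rewrite -(prim_order_dvd (rootq_prim R n_gt0)) gtnNdvd.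
Qed.

Lemma mono_unit a b : mono a b 0 \is a GRing.unit.
Proof.
have unit_n w : w ^+ n = 1 -> w \is a GRing.unit.
  by move=> wn; rewrite -(unitrX_pos _ n_gt0) wn unitr1.
rewrite mono0 unitrMl; apply/unitrX/unit_n.
  exact: pansera_xn H_pansera.
exact: pansera_yn H_pansera.
Qed.

Lemma mono_swap a b : mono a b 0 * z = z * mono b a 0.
Proof.
have zX c : z * x ^+ c = y ^+ c * z.
  elim: c => [|c IHc]; first by rewrite !expr0 mul1r mulr1.
  by rewrite exprSr mulrA IHc -mulrA (pansera_zx H_pansera) mulrA -exprSr.
have zY c : z * y ^+ c = x ^+ c * z.
  elim: c => [|c IHc]; first by rewrite !expr0 mul1r mulr1.
  by rewrite exprSr mulrA IHc -mulrA (pansera_zy H_pansera) mulrA -exprSr.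
by rewrite !mono0 -xy_comm -mulrA -zY mulrA -zX mulrA.
Qed.

(** Left multiplication by g - 1, for g = x^a y^b, commutes with x and y; passing z
    turns g into x^b y^a, which is g itself if b = a, and g^-1 if b = - a
    modulo n.  In the latter case (g - 1) z = z (g^-1 - 1) = - z g^-1 (g - 1). *)
Lemma mono_normal a b : (a <= n)%N -> b = a \/ b = (n - a)%N ->
  forall h, exists h', (mono a b 0 - 1) * h = h' * (mono a b 0 - 1).
Proof.
move=> le_an ab h; set g := mono a b 0.
have gz : exists h', (g - 1) * z = h' * (g - 1).
  rewrite mulrBl mul1r mono_swap; case: ab => abE.
    by exists z; rewrite mulrBr mulr1 /g abE.
  exists (- (z * mono b a 0)); rewrite mulNr mulrBr mulr1 -mulrA.
  suff -> : mono b a 0 * g = 1 by rewrite opprB mulr1.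
  rewrite /g !mono0 !mulrA -[_ * y ^+ a * _]mulrA xy_comm mulrA -exprD -mulrA.
  rewrite -exprD abE subnK // subnKC // (pansera_xn H_pansera).
  by rewrite (pansera_yn H_pansera) mulr1.
have g_comm r s : (g - 1) * (x ^+ r * y ^+ s) = (x ^+ r * y ^+ s) * (g - 1).
  rewrite mulrBr mulrBl mul1r mulr1 /g mono0; congr (_ - _).
  rewrite mulrA -[x ^+ a * _ * _]mulrA xy_comm mulrA -exprD -mulrA -exprD.
  rewrite mulrA -[x ^+ r * _ * _]mulrA xy_comm mulrA -exprD -mulrA -exprD.
  by rewrite addnC [(s + b)%N]addnC.
have [c ->] := mono_expansion h.
elim/big_ind: _ => [|h1 h2 [h1' E1] [h2' E2]|[[r s] l] _].
- by exists 0; rewrite mul0r mulr0.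
- by exists (h1' + h2'); rewrite mulrDr E1 E2 -mulrDl.
have [h' zE] : exists h', (g - 1) * z ^+ l = h' * (g - 1).
  case: l => -[|[|//]] _ /=; last by rewrite expr1.
  by exists 1; rewrite expr0 mulr1 mul1r.
exists (c (r, s, l) *: (x ^+ r * y ^+ s * h')).
by rewrite -scalerAr -scalerAl /mono /= mulrA g_comm -!mulrA zE.
Qed.

Lemma coprime_of_faithful (A : algType K) (act : H -> A -> A) i j u v :
    module_algebra hopf act -> is_pi n x y z act i j u v -> generated_by2 u v ->
    (i <= j)%N -> inner_faithful hopf act ->
  coprime (j ^ 2 - i ^ 2)%N n.
Proof.
move=> Amod pi_uv gen le_ij faith; apply: contraT => ncop; exfalso.
have [a [b [an ab abu abv]]] := noncoprime_sub_sqr n_gt0 le_ij ncop.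
have act_g w c d : act x w = q ^+ c *: w -> act y w = q ^+ d *: w ->
    (n %| c * a + d * b)%N -> act (mono a b 0) w = w.
  move=> xw yw; rewrite (prim_order_dvd (rootq_prim R n_gt0)) => /eqP q1.
  rewrite mono0 (act_mull Amod) (act_exp_eigen Amod _ yw).
  rewrite (scalable_linear (act_linearr Amod _)) /= (act_exp_eigen Amod _ xw).
  by rewrite scalerA -!exprM -exprD addnC q1 scale1r.
apply: (not_inner_faithful Amod (grouplike_mono0 a b) (mono_unit a b)
  (mono_neq1 b an) _ gen _ _ faith).
- by apply: mono_normal => //; apply/ltnW; case/andP: an.
- exact: act_g (pi_xu pi_uv) (pi_yu pi_uv) abu.
exact: act_g (pi_xv pi_uv) (pi_yv pi_uv) abv.
Qed.

End Monomials.

Theorem theorem3p7 (R : realType) (n i j : nat)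
    (n_ge2 : (2 <= n)%N) (lt_ij : (i < j)%N) (le_jn1 : (j <= n - 1)%N)
    (H : falgType R[i]) (hopf : hopf_algebra H) (x y z : H)
    (H_pansera : is_pansera n x y z hopf)
    (A : algType R[i]) (gr : nat -> {pred A}) (A_graded : is_grading gr)
    (u v : A) (A_generated : generated_by2 u v)
    (act : H -> A -> A) (A_modalg : module_algebra hopf act)
    (act_graded : forall (d : nat) (h : H) (a : A), a \in gr d -> act h a \in gr d)
    (A1_basis : ordered_basis2 (gr 1%N) u v)
    (A1_pi : is_pi n x y z act i j u v) :
  inner_faithful hopf act <->
  gcdz (i%:Z ^+ 2 - j%:Z ^+ 2) n%:Z = 1.
Proof.
have n_gt0 : (0 < n)%N by apply: ltnW.
rewrite /gcdz (absz_sub_sqr (ltnW lt_ij)) absz_nat.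
split=> [faith|[/eqP co]].
  by congr _%:Z; apply/eqP; apply: coprime_of_faithful A1_pi _ _ faith => //; exact: ltnW.
exact: (faithful_of_coprime n_gt0 H_pansera A_modalg A1_pi A1_basis.2 lt_ij co).
Qed.
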